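(* Let $s\in[1/2,1)$, let $0<\lambda\le\Lambda$, and let $K:\mathbb{R}\setminus\{0\}\to\mathbb{R}$ be a measurable kernel that is decreasing in $(0,+\infty)$ and such that $K(z)>0$, $K(-z)=K(z)$ and $\frac{\lambda}{|z|^{1+2s}}\le K(z)\le\frac{\Lambda}{|z|^{1+2s}}$ for all $z\ne0$. Let $L u(x)=\mathrm{P.V.}\int_{\mathbb{R}}(u(x)-u(y))K(x-y)\,dy$. Let $c\in L^\infty(\mathbb{R})$ satisfy, for some positive constants $c_0,R_0,\beta_0$, $c(x)\le-c_0<0$ for $x\in\mathbb{R}\setminus[-R_0,R_0]$ and $\|c\|_{C^{\beta_0}(\mathbb{R})}<+\infty$. For some $\alpha>2s-1$, let $w$ and $\widetilde w$ be two odd, bounded, $C^{1,\alpha}$ solutions of the linear equation $L\varphi-c(x)\varphi=0$ in $\mathbb{R}$, with $w>0$ in $(0,+\infty)$. Then $\widetilde w/w$ is constant; that is, there is $k\in\mathbb{R}$ such that $\widetilde w=k\,w$ in $\mathbb{R}$.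
   Context: All functions are real valued on $\mathbb{R}$. $\mathrm{P.V.}\int_{\mathbb{R}}(u(x)-u(y))K(x-y)\,dy=\lim_{\varepsilon\to0^+}\int_{|x-y|>\varepsilon}(u(x)-u(y))K(x-y)\,dy$, and the equation is understood pointwise at every $x\in\mathbb{R}$. A function is $C^{1,\alpha}$ if it is $C^1$ with locally $\alpha$-Hölder continuous derivative. ''Decreasing'' means strictly decreasing (as opposed to nonincreasing). For $\gamma>1$, $C^\gamma=C^{\lfloor\gamma\rfloor,\gamma-\lfloor\gamma\rfloor}$; $\|c\|_{C^{\beta_0}(\mathbb{R})}$ is the global Hölder norm on $\mathbb{R}$. *)

(* Defs.v *)
From HB Require Import structures.
From mathcomp Require Export all_boot all_order all_algebra.
From mathcomp Require Export all_classical all_reals all_analysis.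

Set Implicit Arguments.
Unset Strict Implicit.
Unset Printing Implicit Defensive.

Export Order.TTheory GRing.Theory Num.Theory.
Export numFieldNormedType.Exports.

Local Open Scope classical_set_scope.
Local Open Scope ring_scope.

(* The region of integration excludes y = x, so K 0 is never used: a kernel on
   R \ {0} is represented by a total function with junk value at 0. *)
Definition truncated_op (R : realType) (K u : R -> R) (x eps : R) : \bar R :=
  (\int[lebesgue_measure]_(y in [set y | eps < `|x - y|]%R)
     ((u x - u y) * K (x - y))%:E)%E.

Definition nonlocal_op (R : realType) (K u : R -> R) (x : R) : \bar R :=
  lim (truncated_op K u x eps @[eps --> 0^'+]).

(* [lim] is meaningful only when the limit exists, hence the first conjunct; the
   equation then forces the limit to be finite. *)
Definition solves_linear_eq (R : realType) (K c u : R -> R) : Prop :=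
  forall x : R, cvg (truncated_op K u x eps @[eps --> 0^'+]) /\
    (nonlocal_op K u x - (c x * u x)%:E)%E = 0%E.

Definition is_Ck (R : realType) (k : nat) (f : R -> R) : Prop :=
  (forall j : nat, (j < k)%N -> forall x : R, derivable (derive1n j f) x 1) /\
  continuous (derive1n k f : R -> R).

Definition loc_holder (R : realType) (a : R) (f : R -> R) : Prop :=
  forall A : set R, compact A -> exists C : R,
    forall x y : R, A x -> A y -> `|f x - f y| <= C * `|x - y| `^ a.

Definition is_C1holder_loc (R : realType) (a : R) (f : R -> R) : Prop :=
  is_Ck 1 f /\ loc_holder a (derive1 f).

Definition sup_norm (R : realType) (f : R -> R) : \bar R :=
  ereal_sup [set (`|f x|)%:E | x in [set: R]].

Definition holder_seminorm (R : realType) (a : R) (f : R -> R) : \bar R :=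
  ereal_sup [set (`|f p.1 - f p.2| / `|p.1 - p.2| `^ a)%:E
            | p in [set p : R * R | p.1 != p.2]].

Definition Ck_holder_norm (R : realType) (k : nat) (a : R) (f : R -> R)
    : \bar R :=
  (\sum_(j < k.+1) sup_norm (derive1n j f) + holder_seminorm a (derive1n k f))%E.

(* C^b is C^{0,b} for b <= 1 (Lipschitz for b = 1) and
   C^{floor b, b - floor b} for b > 1. *)
Definition holder_order (R : realType) (b : R) : nat :=
  if b <= 1 then 0%N else Num.truncn b.

Definition finite_holder_norm (R : realType) (b : R) (f : R -> R) : Prop :=
  is_Ck (holder_order b) f /\
  (Ck_holder_norm (holder_order b) (b - (holder_order b)%:R) f < +oo)%E.

(* Main.v *)
Require Import Defs.
From HB Require Import structures.
From mathcomp Require Import ring lra measurable_realfun.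

(** The quotient of two solutions is compared with its extreme value on a
    compact interval, and the comparison is propagated to the whole half-line
    by maximum principles.

    Folding the integral over y < 0 onto y > 0 turns the operator, acting on an
    odd function h, into an operator on the half-line: at x > 0, when no cutoff
    is present,
      L h (x) = int_{y > 0} (h x - h y) (K (x - y) - K (x + y)) dy
                + 2 h x int_{y > 0} K (x + y) dy.
    The difference K (x - y) - K (x + y) is positive because K decreases, so
    this operator obeys the maximum principle, and the last term is a killing
    term whose weight is bounded below by x K (2 x), which blows up like 1 / x at
    the origin because s >= 1/2.  At a negative minimum of h over the half-line
    the equation L h = c h therefore forces c x >= x K (2 x)
    ([no_negative_min]).  This is impossible for x close to 0, since c is bounded
    there ([potential_dominated]), and for x > R0, since c < 0 there.

    Choose r0 > 0 such that c x < x K (2 x) on (0, r0), let k be the maximum of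
    wt / w over [r0, R0], attained at x0, and put v = k w - wt.  Then v >= 0 on
    [r0, R0], and a negative minimum of v on the half-line could only lie where
    it has just been excluded.  Hence v >= 0 on the half-line as soon as its
    infimum is attained; when it is only approached at infinity, a small bump
    translated far away is subtracted so that the minimum becomes attained, and
    the uniform bound c <= - c0 absorbs the error, which is proportional to the
    height of the bump ([weak_maximum_principle]).  Finally v vanishes at x0, a
    minimum point, so the folded integral of v against a positive weight is zero
    and v = 0 ([strong_maximum_principle]).

    The killing term also takes care of the origin, where w vanishes: the
    quotient wt / w is only ever used on [r0, R0].  All estimates are made on the
    truncated operators, uniformly in the cutoff e up to an error O(e), and are
    passed to the limit by [limit_le].  Reflections
    y |-> a - y are the only changes of variables: one folds the line, and the
    one about x symmetrises the truncated operator into second differences. *)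

Set Implicit Arguments.
Unset Strict Implicit.
Unset Printing Implicit Defensive.

Local Open Scope classical_set_scope.
Local Open Scope ring_scope.

(** * Reflections of the line *)

Section reflections.
Context {R : realType}.
Local Notation mu := (@lebesgue_measure R).
Implicit Types (a : R) (D : set (measurableTypeR R)) (f : R -> \bar R).

Lemma measurable_reflect a :
  measurable_fun [set: measurableTypeR R]
    ((fun z => a - z) : measurableTypeR R -> measurableTypeR R).
Proof. by apply: measurable_funB => //. Qed.

Lemma pushforward_reflect a (A : set R) : measurable A ->
  pushforward mu ((fun z => a - z) : measurableTypeR R -> measurableTypeR R) A
  = mu A.
Proof.
move=> mA; apply/esym.
pose f : {mfun measurableTypeR R >-> measurableTypeR R} :=
  HB.pack ((fun z => a - z) : measurableTypeR R -> measurableTypeR R)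
   (isMeasurableFun.Build _ _ _ _ _ (measurable_reflect a)).
apply: (@lebesgue_measure_unique R (pushforward mu f)) => //= _ [[b c]] _ <-.
rewrite /pushforward.
have -> : f @^-1` [set` `]b, c]] = [set` `[a - c, a - b[].
  apply/seteqP; split => z /=; rewrite !in_itv /= => /andP[h1 h2];
   apply/andP; split; lra.
rewrite !lebesgue_measure_itv /= !lte_fin.
have -> : (a - c < a - b) = (b < c) by apply/idP/idP => ?; lra.
by case: ifP => // _; rewrite -!EFinB; congr (_%:E); lra.
Qed.

Lemma measurable_reflect_set a D : measurable D ->
  measurable [set z | D (a - z)].
Proof.
by move=> mD; have := measurable_reflect a measurableT mD; rewrite setTI.
Qed.

Lemma ge0_integral_reflect a D f : measurable D -> measurable_fun D f ->
  {in D, forall y, (0 <= f y)%E} ->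
  (\int[mu]_(y in D) f y = \int[mu]_(z in [set z | D (a - z)%R]) f (a - z)%R)%E.
Proof.
move=> mD mf f0.
rewrite -(ge0_integral_pushforward (measurable_reflect a) mu mD mf f0).
apply: eq_measure_integral => [|mphi A mA _]; first exact: measurable_reflect.
exact/esym/(pushforward_reflect a mA).
Qed.

Lemma integral_reflect a D f : measurable D -> measurable_fun D f ->
  (\int[mu]_(y in D) f y = \int[mu]_(z in [set z | D (a - z)%R]) f (a - z)%R)%E.
Proof.
move=> mD mf; rewrite integralE [RHS]integralE.
rewrite (ge0_integral_reflect a) //; last exact: measurable_funepos.
rewrite [X in (_ - X)%E](ge0_integral_reflect a) //; last exact: measurable_funeneg.
by congr (_ - _)%E; apply: eq_integral => z _; rewrite ?funeposE ?funenegE.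
Qed.

Lemma integrable_reflect a D f : measurable D -> mu.-integrable D f ->
  mu.-integrable [set z | D (a - z)] (fun z => f (a - z)).
Proof.
move=> mD /integrableP[mf fi]; apply/integrableP; split.
  apply: (measurable_comp mD) => //; first by move=> _ [z Dz <-].
  by apply: measurable_funTS; exact: measurable_reflect.
by move: fi; rewrite (ge0_integral_reflect a) //; exact: measurableT_comp.
Qed.

Lemma Rintegral_reflect a D (f : R -> R) : measurable D -> measurable_fun D f ->
  \int[mu]_(y in D) f y = \int[mu]_(z in [set z | D (a - z)]) f (a - z).
Proof.
move=> mD mf; rewrite /Rintegral (integral_reflect a) //.
exact/measurable_EFinP.
Qed.

(** Brings an integral over the line to the half-line, where the values of an
    odd function at y and - y can be compared. *)
Lemma Rintegral_fold (F : R -> R) : mu.-integrable [set: R] (EFin \o F) ->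
  \int[mu]_y F y = \int[mu]_(y in `]0, +oo[) (F y + F (- y)).
Proof.
move=> iF.
have m1 : measurable (`]0, +oo[%classic : set (measurableTypeR R)).
  exact: measurable_itv.
have m2 : measurable (`]-oo, 0]%classic : set (measurableTypeR R)).
  exact: measurable_itv.
have DT : [set: R] = `]0, +oo[%classic `|` `]-oo, 0]%classic.
  apply/seteqP; split => z //= _; rewrite !in_itv /= andbT.
  by have [|] := leP z 0; [right|left].
have i1 : mu.-integrable `]0, +oo[ (EFin \o F) by exact: integrableS iF.
have i2 : mu.-integrable `]-oo, 0] (EFin \o F) by exact: integrableS iF.
have DN : [set z : R | `]-oo, 0]%classic (0 - z)] = `[0, +oo[%classic.
  by apply/seteqP; split => z /=; rewrite !in_itv /= andbT sub0r oppr_le0.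
have i3 := integrable_reflect 0 m2 i2; rewrite DN in i3.
have i4 : mu.-integrable `[0, +oo[ (EFin \o (fun y => F (- y))).
  by apply: eq_integrable i3 => // y _; rewrite sub0r.
have i5 : mu.-integrable `]0, +oo[ (EFin \o (fun y => F (- y))).
  apply: integrableS i4 => //.
  by move=> z /=; rewrite !in_itv /= !andbT => /ltW.
rewrite RintegralD // DT Rintegral_setU //.
- congr (_ + _); rewrite (Rintegral_reflect 0) //; last first.
    by apply/measurable_EFinP; exact: (measurable_int mu i2).
  rewrite DN Rintegral_itv_obnd_cbnd //.
  by apply: eq_Rintegral => y _; rewrite sub0r.
- by rewrite -DT.
- apply/disj_setPS => z /= []; rewrite !in_itv /= andbT => h1 h2.
  by have := lt_le_trans h1 h2; rewrite ltxx.
Qed.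

Lemma integrable_indic_itv (a b : R) (D : set (measurableTypeR R)) : measurable D ->
  mu.-integrable D (EFin \o (\1_(`[a, b]%classic) : R -> R)).
Proof.
move=> mD.
have mI : measurable (`[a, b]%classic : set (measurableTypeR R)).
  exact: measurable_itv.
apply/integrableP; split.
  by apply/measurable_EFinP; exact: measurable_indic.
under eq_integral do rewrite /= ger0_norm //.
rewrite integral_indic //.
apply: (@le_lt_trans _ _ (mu `[a, b])).
  apply: le_measure; rewrite ?inE //.
  exact: measurableI.
by rewrite lebesgue_measure_itv /=; case: ifP => // _; rewrite -EFinB ltry.
Qed.

Lemma Rintegral_indic_itv (a b : R) : 0 < a -> a <= b ->
  \int[mu]_(y in `]0, +oo[) (\1_(`[a, b]%classic) : R -> R) y = b - a.
Proof.
move=> a0 ab.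
have mI : measurable (`[a, b]%classic : set (measurableTypeR R)).
  exact: measurable_itv.
have mP : measurable (`]0, +oo[%classic : set (measurableTypeR R)).
  exact: measurable_itv.
rewrite /Rintegral integral_indic //=.
rewrite setIidl; last first.
  move=> z /=; rewrite !in_itv /= andbT => /andP[az _]; exact: lt_le_trans az.
rewrite lebesgue_measure_itv /= lte_fin.
by case: ltgtP ab => // -> _; rewrite subrr.
Qed.

End reflections.

(** * Two elementary integrals *)

Section power_integrals.
Context {R : realType}.
Local Notation mu := (@lebesgue_measure R).

(** The bound is uniform in the lower endpoint [e]; with a = 2 - 2 s it is the
    integrability of z ^ 2 K z at the origin. *)
Lemma integral_powR_near0 (a e : R) : 0 < a -> 0 < e < 1 ->
  (\int[mu]_(z in `[e, 1%R]) (z `^ (a - 1)%R)%:E <= (a^-1)%:E)%E.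
Proof.
move=> a0 /andP[e0 e1].
have dF (z : R) : 0 < z -> is_derive z (1 : R) (fun t => a^-1 * t `^ a) (z `^ (a - 1)).
  move=> z0; have da := is_derive1_powR a z0.
  have := is_deriveZ a^-1 da.
  by rewrite /GRing.scale /= mulrA mulVf ?mul1r // gt_eqF.
have pos (z : R) : e <= z -> 0 < z by exact: lt_le_trans.
have cF : {within `[e, 1], continuous (fun t => a^-1 * t `^ a)}.
  apply: derivable_within_continuous => z; rewrite in_itv /= => /andP[ez _].
  exact: (@ex_derive _ _ _ _ _ _ _ (dF z (pos z ez))).
rewrite (@continuous_FTC2 _ _ (fun t => a^-1 * t `^ a)) //.
- by rewrite -EFinB lee_fin powR1 mulr1 gerBl mulr_ge0 ?invr_ge0 ?powR_ge0 // ltW.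
- apply: derivable_within_continuous => z; rewrite in_itv /= => /andP[ez _].
  apply: derivable_powR; rewrite in_itv /= andbT; exact: pos.
- have /(continuous_within_itvP _ e1)[_ c1 c2] := cF; split => // z.
  rewrite in_itv /= => /andP[/ltW ez _].
  exact: (@ex_derive _ _ _ _ _ _ _ (dF z (pos z ez))).
- move=> z; rewrite in_itv /= => /andP[/ltW ez _].
  by rewrite derive1E; apply: derive_val; exact: dF z (pos z ez).
Qed.

Lemma integral_invX2 : (\int[mu]_(z in `[1%R, +oo[) (z ^- 2)%:E = 1%:E)%E.
Proof.
have dF (z : R) : 1 <= z -> is_derive z (1 : R) (fun t => - t^-1) (z ^- 2).
  move=> z1.
  have z0 : z != 0 by rewrite gt_eqF // (lt_le_trans ltr01).
  have := is_deriveN (is_deriveV z0 (is_derive_id z (1 : R))).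
  by rewrite scaler1 opprK.
rewrite (@ge0_continuous_FTC2y _ _ (fun t => - t^-1) 1 0).
- by rewrite invr1 sub0e -EFinN opprK.
- by move=> z z1; rewrite invr_ge0 sqr_ge0.
- apply: derivable_within_continuous => z; rewrite in_itv /= andbT => z1.
  apply: derivableV; first by rewrite sqrf_eq0 gt_eqF // (lt_le_trans ltr01).
  exact: exprn_derivable.
- rewrite -oppr0; apply: cvgN; by apply/gtr0_cvgV0 => //; exact: nbhs_pinfty_gt.
- move=> z /ltW z1; exact: (@ex_derive _ _ _ _ _ _ _ (dF z z1)).
- apply: cvg_at_right_filter; apply: cvgN; apply: cvgV; last exact: cvg_id.
  exact: oner_neq0.
- move=> z; rewrite in_itv /= andbT => /ltW z1.
  by rewrite derive1E; apply: derive_val; exact: dF.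
Qed.

End power_integrals.

(** * Limits at the cutoff zero, and the bump function *)

Section one_sided_limit_and_bump.
Context {R : realType}.
Implicit Types (t x y z : R).

(** How the estimates on truncated integrals, which hold up to an error linear in
    the cutoff, are used. *)
Lemma limit_le (f : R -> R) (l A B d : R) : 0 < d ->
  f e @[e --> 0^'+] --> l ->
  (forall e, 0 < e -> e < d -> f e <= A + B * e) -> l <= A.
Proof.
move=> d0 fl fAB.
have AB : A + B * e @[e --> 0^'+] --> A.
  rewrite -[X in _ --> X]addr0 -[X in _ --> _ + X](mulr0 B).
  apply: cvgD; first exact: cvg_cst.
  by apply: cvgM; [exact: cvg_cst|exact: cvg_at_right_filter].
apply: (ler_cvg_to fl AB); near=> e; apply: fAB.
  by near: e; exact: nbhs_right_gt.
by near: e; exact: nbhs_right_lt.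
Unshelve. all: by end_near. Qed.

(** A truncated parabola instead of a smooth bump: only a one-sided bound on its
    second differences is needed, and the maximum of two semiconvex functions
    has one. *)
Definition bump (t y : R) : R := Num.max 0 (1 - (y - t) ^+ 2).

Lemma bump_ge0 t y : 0 <= bump t y.
Proof. by rewrite le_max lexx. Qed.

Lemma bump_le1 t y : bump t y <= 1.
Proof. by rewrite ge_max ler01 gerBl sqr_ge0. Qed.

Lemma bump_out t y : 1 <= `|y - t| -> bump t y = 0.
Proof.
move=> h; apply/max_idPl; rewrite subr_le0 -real_normK ?num_real //.
by rewrite exprn_ege1.
Qed.

Lemma bump_center t : bump t t = 1.
Proof. by rewrite /bump subrr expr0n subr0; apply/max_idPr. Qed.

Lemma continuous_bump t : continuous (bump t).
Proof.
move=> y; apply: (@continuous_max _ _ (cst 0) (fun z => 1 - (z - t) ^+ 2)).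
  exact: cvg_cst.
apply: cvgB; first exact: cvg_cst.
have ct : (z - t) @[z --> y] --> y - t.
  by apply: cvgB; [exact: cvg_id|exact: cvg_cst].
by rewrite expr2; under eq_fun do rewrite expr2; exact: cvgM.
Qed.

(** If the bump vanishes at [x], the left-hand side is at most 0, as the bump is
    nonnegative; otherwise it lies below the second difference of the parabola,
    because the bump lies above the parabola everywhere. *)
Lemma bump_second_difference t x z :
  2 * bump t x - bump t (x - z) - bump t (x + z) <= 2 * z ^+ 2.
Proof.
have := bump_ge0 t (x - z); have := bump_ge0 t (x + z).
have b1 y : 1 - (y - t) ^+ 2 <= bump t y by rewrite le_max lexx orbT.
have := b1 (x - z); have := b1 (x + z).
have [h|h] := leP (1 - (x - t) ^+ 2) 0.
  have -> : bump t x = 0 by exact/max_idPl.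
  have := sqr_ge0 z; lra.
have -> : bump t x = 1 - (x - t) ^+ 2 by apply/max_idPr/ltW.
lra.
Qed.

(** The perturbation has to preserve oddness for the folding to apply. *)
Definition odd_bump t y := bump t y - bump t (- y).

Lemma odd_bumpN t y : odd_bump t (- y) = - odd_bump t y.
Proof. by rewrite /odd_bump opprK opprB. Qed.

Lemma odd_bump_norm t y : `|odd_bump t y| <= 1.
Proof.
have := bump_ge0 t y; have := bump_ge0 t (- y).
have := bump_le1 t y; have := bump_le1 t (- y).
by rewrite /odd_bump ler_norml => *; apply/andP; split; lra.
Qed.

Lemma continuous_odd_bump t : continuous (odd_bump t).
Proof.
move=> y; apply: cvgB; first exact: continuous_bump.
apply: (@continuous_comp _ _ _ -%R (bump t)); last exact: continuous_bump.
exact: opp_continuous.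
Qed.

Lemma odd_bump_pos t y : 1 <= t -> 0 < y -> odd_bump t y = bump t y.
Proof.
move=> t1 y0; rewrite /odd_bump [bump t (- y)]bump_out ?subr0 //.
rewrite ler0_norm; lra.
Qed.

(** Within distance 1 of [x] the mirror bump is invisible, so the estimate is that
    of [bump]; further away the crude bound 4 suffices. *)
Lemma odd_bump_second_difference t x z : 1 <= t -> 1 < x ->
  2 * odd_bump t x - odd_bump t (x - z) - odd_bump t (x + z) <=
  4 * Num.min 1 (z ^+ 2).
Proof.
move=> t1 x1; have n y := odd_bump_norm t y.
have [z1|z1] := leP `|z| 1.
  have z21 : z ^+ 2 <= 1 by rewrite -real_normK ?num_real // expr_le1.
  rewrite (min_idPr z21) !odd_bump_pos //; last 3 first.
  - by move: z1; rewrite ler_norml => /andP[]; lra.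
  - by move: z1; rewrite ler_norml => /andP[]; lra.
  - by lra.
  by have := bump_second_difference t x z; have := sqr_ge0 z; lra.
have z21 : 1 <= z ^+ 2 by rewrite -real_normK ?num_real // exprn_ege1 // ltW.
rewrite (min_idPl z21) mulr1.
have := n x; have := n (x - z); have := n (x + z).
by rewrite !ler_norml => /andP[? ?] /andP[? ?] /andP[? ?]; lra.
Qed.

End one_sided_limit_and_bump.

(** * Levy kernels of order 2 s *)

Section levy_kernel.
Context {R : realType} (s Lambda : R) (K : R -> R).
Context (hs : 2^-1 <= s < 1).
Context (K_meas : measurable_fun [set z : R | z != 0] K).
Context (K_pos : forall z : R, z != 0 -> 0 < K z).
Context (K_even : forall z : R, z != 0 -> K (- z) = K z).
Context (K_decr : forall z1 z2 : R, 0 < z1 -> z1 < z2 -> K z2 < K z1).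
Context (K_le : forall z : R, z != 0 -> K z <= Lambda / `|z| `^ (1 + 2 * s)).
Local Notation mu := (@lebesgue_measure R).

Lemma measurable_far (e : R) :
  measurable ([set z | e < `|z|] : set (measurableTypeR R)).
Proof.
apply: open_measurable.
have -> : [set z : R | e < `|z|] = (fun z : R => `|z|) @^-1` [set t | e < t] by [].
by apply: open_comp; [move=> z _; exact: norm_continuous|exact: open_gt].
Qed.

Lemma measurable_kernel_far (e : R) : 0 < e ->
  measurable_fun [set z : R | e < `|z|] K.
Proof.
move=> e0; apply: measurable_funS K_meas.
  by apply: open_measurable; exact: open_neq.
by move=> z /= ez; rewrite -normr_gt0 (lt_trans e0).
Qed.

Lemma Lambda_ge0 : 0 <= Lambda.
Proof.
have := K_le (oner_neq0 R); rewrite normr1 powR1 divr1; apply: le_trans.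
exact/ltW/K_pos/oner_neq0.
Qed.

(** Its integrability away from 0, uniformly in the cutoff, is the Levy condition
    on the kernel; it controls both the tails of the kernel and the second
    differences of functions that are semiconvex at the point considered. *)
Definition levy_density (z : R) := Num.min 1 (z ^+ 2) * K z.

Lemma levy_density_ge0 (z : R) : z != 0 -> 0 <= levy_density z.
Proof.
by move=> z0; rewrite mulr_ge0 ?(ltW (K_pos z0)) // le_min ler01 sqr_ge0.
Qed.

Lemma levy_density_even (z : R) : z != 0 -> levy_density (- z) = levy_density z.
Proof. by move=> z0; rewrite /levy_density sqrrN K_even. Qed.

Lemma levy_density_near (z : R) : 0 < z ->
  levy_density z <= Lambda * z `^ ((2 - 2 * s) - 1).
Proof.
move=> z0; have zN0 : z != 0 by rewrite gt_eqF.
have := K_le zN0; rewrite gtr0_norm // => Kz.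
apply: (@le_trans _ _ (z ^+ 2 * (Lambda / z `^ (1 + 2 * s)))).
  apply: ler_pM => //; first by rewrite le_min ler01 sqr_ge0.
    exact/ltW/K_pos.
  by rewrite ge_min lexx orbT.
have -> : 2 - 2 * s - 1 = 2%:R - (1 + 2 * s) by lra.
rewrite powRB ?zN0 ?implybT // powR_mulrn ?(ltW z0) //.
by rewrite mulrCA.
Qed.

Lemma levy_density_far (z : R) : 1 <= z -> levy_density z <= Lambda * z ^- 2.
Proof.
move=> z1; have z0 : 0 < z by apply: lt_le_trans z1.
have zN0 : z != 0 by rewrite gt_eqF.
have := K_le zN0; rewrite gtr0_norm // => Kz.
apply: (@le_trans _ _ (1 * (Lambda / z `^ (1 + 2 * s)))).
  apply: ler_pM => //; first by rewrite le_min ler01 sqr_ge0.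
    exact/ltW/K_pos.
  by rewrite ge_min lexx.
rewrite mul1r; apply: ler_wpM2l; first exact: Lambda_ge0.
rewrite lef_pV2 ?posrE ?powR_gt0 ?exprn_gt0 //.
rewrite -powR_mulrn ?(ltW z0) //; apply: ler_powR => //.
by move: hs => /andP[h _]; lra.
Qed.

Lemma measurable_levy_density (e : R) : 0 < e ->
  measurable_fun [set z : R | e < `|z|] levy_density.
Proof.
move=> e0; apply: measurable_funM; last exact: measurable_kernel_far.
by apply: measurable_minr => //; exact: exprn_measurable.
Qed.

(** On (e, 1] the density is at most Lambda z ^ (1 - 2 s), and on (1, +oo) at most
    Lambda / z ^ 2. *)
Lemma levy_density_half (e : R) : 0 < e < 1 ->
  (\int[mu]_(z in `]e, +oo[) (levy_density z)%:E <=
   (Lambda * (2 - 2 * s)^-1 + Lambda)%:E)%E.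
Proof.
move=> /andP[e0 e1].
have eD : `]e, +oo[%classic = `]e, 1%R] `|` `]1%R, +oo[.
  apply/seteqP; split => z /=; rewrite !in_itv /= ?andbT.
    by move=> ->; have [|] := leP z 1; [left|right].
  by move=> [/andP[]//|]; apply: lt_trans.
have sub_far (A : set R) : A `<=` `]e, +oo[ -> measurable A ->
    measurable_fun A (EFin \o levy_density).
  move=> AD mA; apply/measurable_EFinP.
  apply: measurable_funS (measurable_levy_density e0).
    exact: measurable_far.
  by move=> z /AD /=; rewrite in_itv /= andbT => h; rewrite (lt_le_trans h) // ler_norm.
have pos z : e < z -> 0 <= levy_density z.
  by move=> ez; apply: levy_density_ge0; rewrite gt_eqF // (lt_trans e0).
rewrite eD ge0_integral_setU //=; first last.
- apply/disj_setPS => z /= []; rewrite !in_itv /= andbT => /andP[_ h1] h2; lra.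
- move=> z zD; have : `]e, +oo[%classic z by rewrite eD.
  by rewrite /= in_itv /= andbT => ez; rewrite lee_fin pos.
- by apply: sub_far; [rewrite eD|exact: measurableU].
rewrite EFinD; apply: leeD.
- apply: (@le_trans _ _ (\int[mu]_(z in `]e, 1%R]) (Lambda%:E * (z `^ ((2 - 2 * s) - 1))%:E))%E).
    apply: ge0_le_integral => //.
    + by move=> z /=; rewrite in_itv /= => /andP[ez _]; rewrite lee_fin pos.
    + by apply: sub_far => //; rewrite eD; exact: subsetUl.
    + apply: measurable_funeM; apply/measurable_EFinP.
      by apply: measurable_funTS; exact: measurable_powR.
    + move=> z /=; rewrite in_itv /= => /andP[ez _].
      by rewrite -EFinM lee_fin levy_density_near // (lt_trans e0).
  rewrite ge0_integralZl ?lee_fin ?Lambda_ge0 //; first last.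
  + by move=> z _; rewrite lee_fin powR_ge0.
  + apply/measurable_EFinP; apply: measurable_funTS; exact: measurable_powR.
  rewrite EFinM; apply: lee_wpmul2l; first by rewrite lee_fin Lambda_ge0.
  rewrite integral_itv_obnd_cbnd; last first.
    apply/measurable_EFinP; apply: measurable_funTS; exact: measurable_powR.
  apply: integral_powR_near0; last by rewrite e0.
  by move: hs => /andP[_ h]; lra.
- have mX2 (A : set R) : measurable A -> A `<=` `]1%R, +oo[ ->
      measurable_fun A (fun z : R => (z ^- 2)%:E).
    move=> mA AD; apply/measurable_EFinP.
    apply: (@measurable_funS _ _ _ _ [set z : R | z != 0]).
    + by apply: open_measurable; exact: open_neq.
    + move=> z /AD /=; rewrite in_itv /= andbT => h.
      by rewrite gt_eqF // (lt_trans ltr01).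
    + apply: open_continuous_measurable_fun; first exact: open_neq.
      move=> z; rewrite inE /= => z0.
      apply: cvgV; first by rewrite sqrf_eq0.
      exact: exprn_continuous.
  apply: (@le_trans _ _ (\int[mu]_(z in `]1%R, +oo[) (Lambda%:E * (z ^- 2)%:E))%E).
    apply: ge0_le_integral => //.
    + move=> z /=; rewrite in_itv /= andbT => ez; rewrite lee_fin pos //.
      exact: lt_trans ez.
    + by apply: sub_far => //; rewrite eD; exact: subsetUr.
    + by apply: measurable_funeM; exact: mX2.
    + move=> z /=; rewrite in_itv /= andbT => ez.
      by rewrite -EFinM lee_fin levy_density_far // ltW.
  rewrite ge0_integralZl ?lee_fin ?Lambda_ge0 //; first last.
  + by move=> z _; rewrite lee_fin invr_ge0 sqr_ge0.
  + exact: mX2.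
  by rewrite integral_itv_obnd_cbnd ?integral_invX2 ?mule1 //; exact: mX2.
Qed.

Definition levy_mass : R := 2 * (Lambda * (2 - 2 * s)^-1 + Lambda).

Lemma levy_density_mass (e : R) : 0 < e < 1 ->
  (\int[mu]_(z in [set z : R | (e < `|z|)%R]) (levy_density z)%:E <= levy_mass%:E)%E.
Proof.
move=> /[dup] he /andP[e0 e1].
have eD : [set z : R | e < `|z|] =
    `]e, +oo[%classic `|` [set z | `]e, +oo[%classic (0 - z)].
  apply/seteqP; split => z /=; rewrite !in_itv /= ?andbT sub0r ltr_normr.
    by move=> /orP[]; [left|right].
  by move=> [->|->]; rewrite ?orbT.
have mD : measurable `]e, +oo[%classic by exact: measurable_itv.
have pos z : e < `|z| -> 0 <= levy_density z.
  by move=> ez; apply: levy_density_ge0; rewrite -normr_gt0 (lt_trans e0).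
have mg : measurable_fun [set z : R | e < `|z|] (EFin \o levy_density).
  by apply/measurable_EFinP; exact: measurable_levy_density.
have mg' : measurable_fun `]e, +oo[ (EFin \o levy_density).
  apply: measurable_funS mg; first exact: measurable_far.
  by rewrite eD; exact: subsetUl.
rewrite eD ge0_integral_setU //=; first last.
- apply/disj_setPS => z /= []; rewrite !in_itv /= !andbT => h1 h2; lra.
- move=> z zD; have ez : [set z : R | e < `|z|] z by rewrite eD.
  by rewrite lee_fin pos.
- by rewrite -eD.
- exact: (measurable_reflect_set 0 mD).
have -> : (\int[mu]_(z in [set z | `]e, +oo[%classic (0 - z)%R]) (levy_density z)%:E =
    \int[mu]_(z in `]e, +oo[) (levy_density z)%:E)%E.
  rewrite [RHS](ge0_integral_reflect 0) //; last first.
    move=> z; rewrite inE /= in_itv /= andbT => ez.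
    by rewrite lee_fin pos // (lt_le_trans ez) // ler_norm.
  apply: eq_integral => z; rewrite inE /= in_itv /= andbT sub0r => ez.
  rewrite levy_density_even // -oppr_eq0 gt_eqF //; exact: lt_trans ez.
by rewrite /levy_mass mulr_natl mulr2n EFinD leeD // levy_density_half.
Qed.

(** * Truncated operators *)

Definition bounded_continuous (u : R -> R) :=
  continuous u /\ exists M, forall x, `|u x| <= M.

Definition far_from (x e : R) : set (measurableTypeR R) := [set y | e < `|x - y|].

Lemma measurable_far_from (x e : R) : measurable (far_from x e).
Proof. exact: (measurable_reflect_set x (measurable_far e)). Qed.

Lemma integrable_levy_density (e : R) : 0 < e < 1 ->
  mu.-integrable [set z : R | e < `|z|] (EFin \o levy_density).
Proof.
move=> /[dup] he /andP[e0 e1].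
have mD := measurable_far e.
have mg : measurable_fun [set z : R | e < `|z|] (EFin \o levy_density).
  by apply/measurable_EFinP; exact: measurable_levy_density.
apply/integrableP; split => //.
apply: le_lt_trans (ltry levy_mass).
apply: le_trans (levy_density_mass he).
apply: ge0_le_integral => //; first exact: measurableT_comp.
move=> z /= ez; rewrite lee_fin ger0_norm // levy_density_ge0 //.
by rewrite -normr_gt0 (lt_trans e0).
Qed.

(** Off the ball of radius [e] the weight min 1 (z ^ 2) is at least e ^ 2. *)
Lemma integrable_kernel_far (e : R) : 0 < e < 1 ->
  mu.-integrable [set z : R | e < `|z|] (EFin \o K).
Proof.
move=> /[dup] he /andP[e0 e1].
have mD := measurable_far e.
have ig := integrable_levy_density he.
apply: le_integrable (integrableZl mD (e ^+ 2)^-1 ig) => //.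
  by apply/measurable_EFinP; exact: measurable_kernel_far.
move=> z /= ez; have z0 : z != 0 by rewrite -normr_gt0 (lt_trans e0).
have Kz := K_pos z0.
have e2 : 0 < e ^+ 2 by exact: exprn_gt0.
rewrite lee_fin !ger0_norm ?(ltW Kz) //; last first.
  by rewrite mulr_ge0 ?invr_ge0 ?(ltW e2) // levy_density_ge0.
rewrite -ler_pdivrMl ?invr_gt0 // invrK /levy_density.
apply: ler_wpM2r; first exact: ltW.
rewrite le_min expr_le1 ?(ltW e0) // (ltW e1) /= -[leRHS]real_normK ?num_real //.
by rewrite lerXn2r ?nnegrE ?(ltW e0) // ltW.
Qed.

Lemma integrable_integrand (u : R -> R) (x e : R) :
  bounded_continuous u -> 0 < e < 1 ->
  mu.-integrable (far_from x e) (fun y => ((u x - u y) * K (x - y))%:E).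
Proof.
move=> [cu [M uM]] he.
have iK := integrable_reflect x (measurable_far e) (integrable_kernel_far he).
have := @integrableMr _ _ _ mu _ (measurable_far_from x e)
  (fun y => u x - u y) _ _ _ iK.
apply.
  apply: measurable_funTS; apply: measurable_funB => //.
  exact: continuous_measurable_fun.
exists (M + M); split; first exact: num_real.
move=> B MB y _ /=; apply: le_trans (ltW MB).
by apply: (le_trans (ler_normB _ _)); exact: lerD.
Qed.

(** Real-valued counterpart of [truncated_op]; the two agree on bounded continuous
    functions by [truncated_opE]. *)
Definition rtrunc (u : R -> R) (x e : R) : R :=
  \int[mu]_(y in far_from x e) ((u x - u y) * K (x - y)).

Lemma truncated_opE (u : R -> R) (x e : R) :
  bounded_continuous u -> 0 < e < 1 -> truncated_op K u x e = (rtrunc u x e)%:E.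
Proof.
move=> hu he; rewrite /rtrunc /Rintegral fineK //.
apply: integrable_fin_num; first exact: measurable_far_from.
exact: integrable_integrand.
Qed.

Lemma rtrunc_lin (a b : R) (u v : R -> R) (x e : R) :
  bounded_continuous u -> bounded_continuous v -> 0 < e < 1 ->
  rtrunc (fun y => a * u y + b * v y) x e = a * rtrunc u x e + b * rtrunc v x e.
Proof.
move=> hu hv he; have mD := measurable_far_from x e.
have iu := integrable_integrand x hu he.
have iv := integrable_integrand x hv he.
rewrite /rtrunc -!RintegralZl // -RintegralD //; first last.
- exact: (integrableZl mD b iv).
- exact: (integrableZl mD a iu).
by apply: eq_Rintegral => y _; ring.
Qed.

(** The substitution y = x - z, followed by z |-> - z, writes the truncated
    integral in two ways over the same domain; their sum is the integral of the
    second difference of [u] against [K]. *)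
Lemma rtrunc_le_second_difference (u : R -> R) (C x e : R) :
  bounded_continuous u -> 0 < e < 1 -> 0 <= C ->
  (forall z, 2 * u x - u (x - z) - u (x + z) <= C * Num.min 1 (z ^+ 2)) ->
  2 * rtrunc u x e <= C * levy_mass.
Proof.
move=> hu he C0 uC.
have mD := measurable_far e.
have iu := integrable_integrand x hu he.
have mF := measurable_far_from x e.
have mu_u := measurable_int mu iu.
have DE : [set z | far_from x e (x - z)] = [set z : R | e < `|z|].
  by apply/seteqP; split => z; rewrite /far_from /= subKr.
have DN : [set z : R | e < `|0 - z|] = [set z : R | e < `|z|].
  by apply/seteqP; split => z /=; rewrite sub0r normrN.
(* f1 comes from y = x - z, and f2 from f1 by z |-> - z, using that K is even. *)
pose f1 z := (u x - u (x - z)) * K z.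
pose f2 z := (u x - u (x + z)) * K z.
have i1 : mu.-integrable [set z : R | e < `|z|] (EFin \o f1).
  have := integrable_reflect x (measurable_far_from x e) iu; rewrite DE.
  by apply: eq_integrable => // z _; rewrite /f1 /= subKr.
have E1 : rtrunc u x e = \int[mu]_(z in [set z : R | e < `|z|]) f1 z.
  rewrite /rtrunc (Rintegral_reflect x) //; last exact/measurable_EFinP.
  rewrite DE.
  by apply: eq_Rintegral => z _; rewrite /f1 /= subKr.
have i2 : mu.-integrable [set z : R | e < `|z|] (EFin \o f2).
  have := integrable_reflect 0 (measurable_far e) i1; rewrite DN.
  apply: eq_integrable => // z /set_mem /= ez.
  by rewrite /f1 /f2 sub0r opprK K_even // -normr_gt0 (lt_trans _ ez) //; case/andP: he.
have E2 : rtrunc u x e = \int[mu]_(z in [set z : R | e < `|z|]) f2 z.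
  rewrite E1 (Rintegral_reflect 0) //; last first.
    by apply/measurable_EFinP; exact: (measurable_int mu i1).
  rewrite DN; apply: eq_Rintegral => z /set_mem /= ez.
  by rewrite /f1 /f2 sub0r opprK K_even // -normr_gt0 (lt_trans _ ez) //; case/andP: he.
have ig := integrable_levy_density he.
have -> : 2 * rtrunc u x e = \int[mu]_(z in [set z : R | e < `|z|]) (f1 z + f2 z).
  by rewrite RintegralD // mulr_natl mulr2n -E1 -E2.
apply: (@le_trans _ _ (C * \int[mu]_(z in [set z : R | e < `|z|]) levy_density z)).
  rewrite -RintegralZl //; apply: le_Rintegral => //.
  - exact: (integrableD mD i1 i2).
  - exact: (integrableZl mD C ig).
  - move=> z /= ez; rewrite /f1 /f2 -mulrDl /levy_density mulrA.
    apply: ler_wpM2r; last by apply: le_trans (uC z); lra.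
    by apply/ltW/K_pos; rewrite -normr_gt0 (lt_trans _ ez) //; case/andP: he.
apply: ler_wpM2l => //.
rewrite -lee_fin /Rintegral fineK ?levy_density_mass //.
exact: integrable_fin_num.
Qed.

(** * Folding at a minimum point *)

Lemma kernel_le (y z : R) : 0 < y -> y <= z -> K z <= K y.
Proof.
by move=> y0; rewrite le_eqVlt => /predU1P[->//|yz]; exact/ltW/K_decr.
Qed.

Lemma kernel_norm (z : R) : z != 0 -> K `|z| = K z.
Proof. by move=> z0; have [//|_] := ger0P z; exact: K_even. Qed.

Lemma kernel_near_le_far (x y : R) : 0 < x -> 0 < y -> x != y ->
  K (x + y) <= K (x - y).
Proof.
move=> x0 y0 xy; have xy0 : x - y != 0 by rewrite subr_eq0.
rewrite -(kernel_norm xy0); apply: kernel_le; first by rewrite normr_gt0.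
by rewrite ler_norml; apply/andP; split; lra.
Qed.

(** The folded integrand at a minimum is the opposite of
      (h y - h x) (K (x - y) - K (x + y)) - 2 h x K (x + y),
    which is nonnegative, except within distance [e] of [x]; there the cutoff
    removes the part with K (x - y), and what remains exceeds 2 h x K (x + y) by
    at most 2 M K x, on an interval of length 2 e.  The parameters [a], [b], [p]
    keep whatever gain is available on some interval [a, b]: the killing term for
    the weak maximum principle, the value of [h] for the strong one. *)
Lemma rtrunc_at_min (h : R -> R) (M x e a b p : R) :
  (forall y, h (- y) = - h y) -> continuous h -> (forall y, `|h y| <= M) ->
  0 < e < 1 -> e < x -> h x <= 0 -> (forall y, 0 < y -> h x <= h y) ->
  0 < a -> a <= b ->
  (forall y, a <= y <= b -> e < `|x - y| ->
     p <= (h y - h x) * (K (x - y) - K (x + y)) - 2 * h x * K (x + y)) ->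
  (forall y, a <= y <= b -> `|x - y| <= e -> p <= - (2 * h x * K (x + y))) ->
  rtrunc h x e <= - p * (b - a) + 2 * M * K x * (2 * e).
Proof.
move=> hN ch hM he ex hx0 hmin a0 ab pfar pnear.
have e0 : 0 < e by case/andP: he.
have x0 : 0 < x by exact: lt_trans ex.
have mF := measurable_far_from x e.
have hbc : bounded_continuous h by split => //; exists M.
have M0 : 0 <= M by apply: le_trans (hM 0).
have Kx : 0 < K x by apply: K_pos; rewrite gt_eqF.
have mP : measurable (`]0, +oo[%classic : set (measurableTypeR R)).
  exact: measurable_itv.
(* F is extended by 0 to the ball around x that the cutoff removes, so that the
   integral to be folded runs over the whole line. *)
pose F := (fun y => (h x - h y) * K (x - y)) \_ (far_from x e).
have iF : mu.-integrable [set: R] (EFin \o F).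
  have := integrable_integrand x hbc he.
  rewrite -[X in mu.-integrable X _]setTI => /integrable_restrict.
  by rewrite /F -restrict_EFin; apply.
have iFP : mu.-integrable `]0, +oo[ (EFin \o F) by exact: integrableS iF.
have iFN : mu.-integrable `]0, +oo[ (EFin \o (fun y => F (- y))).
  have mT : measurable ([set: R] : set (measurableTypeR R)) by exact: measurableT.
  have := integrable_reflect 0 mT iF.
  move=> /(integrableS mT mP (@subsetT _ _)).
  by apply: eq_integrable => // y _; rewrite sub0r.
have -> : rtrunc h x e = \int[mu]_(y in `]0, +oo[) (F y + F (- y)).
  by rewrite /rtrunc Rintegral_mkcond Rintegral_fold.
have iA := integrable_indic_itv a b mP.
have iB := integrable_indic_itv (x - e) (x + e) mP.
have -> : - p * (b - a) + 2 * M * K x * (2 * e) =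
    \int[mu]_(y in `]0, +oo[) (- p * (\1_(`[a, b]%classic) : R -> R) y +
      2 * M * K x * (\1_(`[x - e, x + e]%classic) : R -> R) y).
  rewrite RintegralD //; first last.
  - exact: (integrableZl mP (2 * M * K x) iB).
  - exact: (integrableZl mP (- p) iA).
  rewrite !RintegralZl // !Rintegral_indic_itv //; [|lra..].
  by congr (_ + _ * _); lra.
apply: le_Rintegral => //.
- exact: (integrableD mP iFP iFN).
- exact: (integrableD mP (integrableZl mP (- p) iA) (integrableZl mP (2 * M * K x) iB)).
move=> y /=; rewrite in_itv /= andbT => y0.
have hyM := hM y; have hxM := hM x; rewrite !ler_norml in hyM hxM.
have hxy := hmin y y0.
have Kxy : 0 < K (x + y) by apply: K_pos; rewrite gt_eqF // addr_gt0.
have KxyKx : K (x + y) <= K x by apply: kernel_le => //; lra.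
have FN : F (- y) = (h x + h y) * K (x + y).
  rewrite /F patchE mem_set ?hN ?opprK // /far_from /= opprK ger0_norm; lra.
have FE : F y = if `|x - y| <= e then 0 else (h x - h y) * K (x - y).
  rewrite /F patchE; case: leP => xye; first by rewrite memNset //; apply/negP; rewrite -leNgt.
  by rewrite mem_set.
rewrite FN FE !indicE !mem_setE !in_itv /=.
have -> : (x - e <= y <= x + e) = (`|x - y| <= e).
  by rewrite ler_norml; apply/idP/idP => /andP[? ?]; apply/andP; split; lra.
have [xye|xye] := leP `|x - y| e.
  have : (h y - h x) * K (x + y) <= 2 * M * K x.
    by apply: ler_pM => //; try exact: ltW; case/andP: hyM; case/andP: hxM; lra.
  have [yab|_] /= := boolP (a <= y <= b).
    by have := pnear y yab xye; lra.
  have : h x * K (x + y) <= 0 by rewrite pmulr_lle0.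
  lra.
have xy : x != y by apply: contraTneq xye => ->; rewrite subrr normr0 -leNgt ltW.
have [yab|_] /= := boolP (a <= y <= b).
  by have := pfar y yab xye; lra.
have : h x * K (x + y) <= 0 by rewrite pmulr_lle0.
have : 0 <= (h y - h x) * (K (x - y) - K (x + y)).
  by rewrite mulr_ge0 // subr_ge0 // kernel_near_le_far.
lra.
Qed.

(** On [x / 2, x] one has K (x + y) >= K (2 x), so the killing term contributes at
    least x K (2 x) / 2, twice. *)
Lemma rtrunc_at_negative_min (h : R -> R) (M x e : R) :
  (forall y, h (- y) = - h y) -> continuous h -> (forall y, `|h y| <= M) ->
  0 < e < 1 -> e < x -> h x <= 0 -> (forall y, 0 < y -> h x <= h y) ->
  rtrunc h x e <= h x * (x * K (2 * x)) + 4 * M * K x * e.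
Proof.
move=> hN ch hM he ex hx0 hmin.
have e0 : 0 < e by case/andP: he.
have x0 : 0 < x by exact: lt_trans ex.
have KK y : x / 2 <= y <= x -> h x * K (x + y) <= h x * K (2 * x).
  move=> /andP[y1 y2]; rewrite ler_wnM2l //; apply: kernel_le; lra.
apply: (le_trans (@rtrunc_at_min h M x e (x / 2) x (- (2 * h x * K (2 * x)))
  hN ch hM he ex hx0 hmin _ _ _ _)); [lra|lra| | |].
- move=> y yx xye; have y0 : 0 < y by case/andP: yx; lra.
  have xy : x != y.
    apply: contraTneq xye => ->; rewrite subrr normr0 -leNgt ltW //.
  have : 0 <= (h y - h x) * (K (x - y) - K (x + y)).
    apply: mulr_ge0; rewrite subr_ge0; first exact: hmin.
    exact: kernel_near_le_far.
  by have := KK y yx; lra.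
- by move=> y yx _; have := KK y yx; lra.
- by rewrite le_eqVlt; apply/orP; left; apply/eqP; field.
Qed.

Lemma solution_cvg (c u : R -> R) (x : R) :
  bounded_continuous u -> solves_linear_eq K c u ->
  rtrunc u x e @[e --> 0^'+] --> c x * u x.
Proof.
move=> hu /(_ x)[cu]; rewrite /nonlocal_op => eqn.
have limE : lim (truncated_op K u x e @[e --> 0^'+]) = (c x * u x)%:E.
  case: (lim _) eqn => [r| |] //=.
  by rewrite -EFinB => -[] /eqP; rewrite subr_eq0 => /eqP ->.
rewrite /cvg_to limE in cu.
apply: cvg_trans (fine_cvg cu); apply: near_eq_cvg; near=> e => /=.
rewrite truncated_opE //; apply/andP; split.
  by near: e; exact: nbhs_right_gt.
by near: e; exact: nbhs_right_lt.
Unshelve. all: by end_near. Qed.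

Lemma solution_lin_cvg (c u w : R -> R) (a b x : R) :
  bounded_continuous u -> solves_linear_eq K c u ->
  bounded_continuous w -> solves_linear_eq K c w ->
  rtrunc (fun y => a * u y + b * w y) x e @[e --> 0^'+] -->
  c x * (a * u x + b * w x).
Proof.
move=> hu su hw sw.
have au : a * rtrunc u x e @[e --> 0^'+] --> a * (c x * u x).
  by apply: cvgM; [exact: cvg_cst|exact: solution_cvg].
have bw : b * rtrunc w x e @[e --> 0^'+] --> b * (c x * w x).
  by apply: cvgM; [exact: cvg_cst|exact: solution_cvg].
have -> : c x * (a * u x + b * w x) = a * (c x * u x) + b * (c x * w x) by ring.
apply: cvg_trans (cvgD au bw); apply: near_eq_cvg; near=> e => /=.
rewrite rtrunc_lin //; apply/andP; split.
  by near: e; exact: nbhs_right_gt.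
by near: e; exact: nbhs_right_lt.
Unshelve. all: by end_near. Qed.

(** * Maximum principles for odd solutions *)

Lemma levy_mass_ge0 : 0 <= levy_mass.
Proof.
have L0 := Lambda_ge0; rewrite /levy_mass mulr_ge0 // addr_ge0 // mulr_ge0 //.
by rewrite invr_ge0; case/andP: hs; lra.
Qed.

Section linear_equation.
Context (c v : R -> R) (M : R).
Context (v_odd : forall x, v (- x) = - v x).
Context (v_cont : continuous v).
Context (v_le : forall x, `|v x| <= M).
Context (v_sol : forall x, rtrunc v x e @[e --> 0^'+] --> c x * v x).

(** Otherwise c x v x <= v x (x K (2 x)), and dividing by v x < 0 gives
    c x >= x K (2 x). *)
Lemma no_negative_min (x : R) : 0 < x -> c x < x * K (2 * x) -> v x < 0 ->
  ~ (forall y, 0 < y -> v x <= v y).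
Proof.
move=> x0 cx vx vmin.
have : c x * v x <= v x * (x * K (2 * x)).
  apply: (@limit_le _ _ _ _ (4 * M * K x) (Num.min 1 x) _ (@v_sol x)).
    by rewrite lt_min ltr01.
  move=> e e0; rewrite lt_min => /andP[e1 ex].
  by apply: rtrunc_at_negative_min => //; [rewrite e0|exact: ltW].
by rewrite mulrC ler_nM2l // leNgt cx.
Qed.

(** If v were positive at y, it would be bounded below near y, where the folded
    kernel is too; the truncated integrals at x would then stay below a negative
    constant, whereas they tend to c x v x = 0. *)
Lemma strong_maximum_principle (x : R) : 0 < x -> v x = 0 ->
  (forall y, 0 < y -> 0 <= v y) -> forall y, 0 < y -> v y = 0.
Proof.
move=> x0 vx0 v0 y y0; apply/eqP; rewrite eq_le v0 // andbT leNgt.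
apply/negP => vy.
have xy : x != y by apply: contraTneq vy => <-; rewrite vx0 ltxx.
have xy0 : 0 < `|x - y| by rewrite normr_gt0 subr_eq0.
have /cvgrPdist_lt/(_ (v y / 2)) := @v_cont y.
rewrite divr_gt0 // => /(_ isT) /nbhs_ballP[d /= d0 vd].
(* The bounds on r keep [y - r, y + r] inside the half-line, away from x, and
   near_pt < far_pt below. *)
pose r := Num.min (d / 2) (Num.min (`|x - y| / 2) (Num.min x y / 2)).
have [r0 rd rxy rx ry] : [/\ 0 < r, r < d, r <= `|x - y| / 2, r <= x / 2 & r <= y / 2].
  split.
  - by rewrite !lt_min !divr_gt0 // lt_min x0.
  - by rewrite !gt_min; apply/orP; left; lra.
  - by rewrite !ge_min lexx orbT.
  - by rewrite !ge_min; apply/orP; right; apply/orP; right; rewrite ler_pM2r // ge_min lexx.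
  - by rewrite !ge_min; apply/orP; right; apply/orP; right; rewrite ler_pM2r // ge_min lexx orbT.
have near_y z : y - r <= z <= y + r -> `|y - z| <= r.
  by move=> /andP[? ?]; rewrite ler_norml; apply/andP; split; lra.
have vz z : y - r <= z <= y + r -> v y / 2 <= v z.
  move=> zy; have : `|v y - v z| < v y / 2.
    by apply: vd; apply: le_lt_trans rd; exact: near_y.
  by rewrite ltr_norml => /andP[? ?]; lra.
(* On [y - r, y + r] the points x - z and x + z stay respectively closer to and
   farther from 0 than these two values, so the folded kernel is at least
   K near_pt - K far_pt there. *)
pose near_pt := `|x - y| + r; pose far_pt := x + y - r.
have nf : near_pt < far_pt.
  rewrite /near_pt /far_pt -ltrBrDr ltr_norml; apply/andP; split; lra.
have kap : 0 < K near_pt - K far_pt by rewrite subr_gt0 K_decr // addr_gt0.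
have : c x * v x <= - (v y / 2 * (K near_pt - K far_pt)) * (2 * r).
  apply: (@limit_le _ _ _ _ (4 * M * K x) (Num.min 1 (Num.min x (`|x - y| / 2))) _ (@v_sol x)).
    by rewrite !lt_min ltr01 x0 divr_gt0.
  move=> e e0; rewrite !lt_min => /and3P[e1 ex exy].
  have he : 0 < e < 1 by rewrite e0.
  have vx_le0 : v x <= 0 by rewrite vx0.
  have vmin z : 0 < z -> v x <= v z by rewrite vx0; exact: v0.
  have a0 : 0 < y - r by lra.
  have ab : y - r <= y + r by lra.
  have dist z : y - r <= z <= y + r ->
      `|x - y| - r <= `|x - z| /\ `|x - z| <= near_pt.
    move=> /near_y zy; rewrite /near_pt; split.
      by have := ler_distD z x y; rewrite [`|z - y|]distrC; lra.
    by have := ler_distD y x z; lra.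
  apply: (le_trans (@rtrunc_at_min v M x e (y - r) (y + r)
    (v y / 2 * (K near_pt - K far_pt))
    v_odd v_cont v_le he ex vx_le0 vmin a0 ab _ _)).
  - move=> z zy xze; rewrite vx0 subr0 mulr0 mul0r subr0.
    have [d1 d2] := dist z zy.
    apply: ler_pM; [lra|exact: ltW|exact: vz|].
    have xz : x - z != 0 by rewrite -normr_gt0; lra.
    apply: lerB.
      by rewrite -(kernel_norm xz); apply: kernel_le => //; lra.
    by apply: kernel_le; rewrite /far_pt; case/andP: zy; lra.
  - by move=> z zy; have [d1 _] := dist z zy; lra.
  - by rewrite le_eqVlt; apply/orP; left; apply/eqP; ring.
rewrite vx0 mulr0 mulNr oppr_ge0 leNgt mulr_gt0 // ?mulr_gt0 //; lra.
Qed.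

(** A minimum of v over the half-line would be excluded by [no_negative_min].  If
    the infimum I < 0 is not attained, it is approached at points t far from the
    origin; subtracting the odd bump of height [del] at such a t creates a
    minimum z near t, with v z < I + del.  The equation at z gives
    - c0 (I + del) <= c z v z <= 2 del levy_mass, which fails for small [del]. *)
Lemma weak_maximum_principle (c0 r0 R0 : R) : 0 < c0 -> 0 < R0 ->
  (forall x, 0 < x -> x < r0 -> c x < x * K (2 * x)) ->
  (forall x, R0 < x -> c x <= - c0) ->
  (forall x, r0 <= x <= R0 -> 0 <= v x) ->
  forall x, 0 < x -> 0 <= v x.
Proof.
move=> c00 R00 c_near c_far v_mid x x0; rewrite leNgt; apply/negP => vx.
have v00 : v 0 = 0 by have := v_odd 0; rewrite oppr0; lra.
have cK z : 0 < z -> v z < 0 -> c z < z * K (2 * z).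
  move=> z0 vz; have [zr|rz] := ltP z r0; first exact: c_near.
  have [zR|Rz] := leP z R0.
    by have := v_mid z; rewrite rz zR leNgt vz => /(_ isT).
  apply: (@lt_trans _ _ 0); first by have := c_far z Rz; lra.
  by rewrite mulr_gt0 // K_pos // gt_eqF // mulr_gt0.
have R2 : 0 <= R0 + 2 by lra.
(* The margin 2 leaves room for the bump: when the minimum over [0, R0 + 2] is not
   global, points with v smaller are centres t > R0 + 2, and the support of the
   bump, of radius 1, stays beyond R0 + 1. *)
have [x1 x1in x1min] := EVT_min R2 (@continuous_subspaceT _ _ _ _ v_cont).
have vx1 : v x1 <= 0 by rewrite -v00; apply: x1min; rewrite in_itv /= lexx.
have [x1glob|/existsNP[x2 /not_implyP[x20 /negP]]] :=
  pselect (forall y, 0 < y -> v x1 <= v y).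
  have vx1' : v x1 < 0 by apply: le_lt_trans vx; exact: x1glob.
  have x10 : 0 < x1.
    rewrite lt_neqAle; move: x1in; rewrite in_itv /= => /andP[-> _].
    by rewrite andbT; apply: contraTneq vx1' => <-; rewrite v00 ltxx.
  by apply: (no_negative_min x10 _ vx1' x1glob); exact: cK.
rewrite -ltNge => vx2.
pose S := [set v y | y in [set y | 0 < y]].
have hS : has_inf S.
  split; first by exists (v x2); exists x2.
  exists (- M) => _ [y _ <-]; have := v_le y; rewrite ler_norml => /andP[]//.
have infS y : 0 < y -> inf S <= v y.
  by move=> y0; apply: ge_inf; [exact: hS.2|exists y].
have I1 : inf S < v x1 by apply: le_lt_trans vx2; exact: infS.
have I0 : inf S < 0 by exact: lt_le_trans vx1.
set I := inf S in infS I1 I0.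
have m0 := levy_mass_ge0.
(* del solves del (4 levy_mass + 2 c0) = - I c0, twice as strong as needed to get
   a strict inequality in the end. *)
pose D := 4 * levy_mass + 2 * c0.
have D0 : 0 < D by rewrite /D; lra.
pose del := - I * c0 / D.
have del0 : 0 < del by rewrite /del divr_gt0 // mulr_gt0 // oppr_gt0.
have delD : del * D = - I * c0 by rewrite /del divfK // gt_eqF.
have [t t0 [vt vt1]] : exists2 t, 0 < t & v t < I + del /\ v t < v x1.
  have e0 : 0 < Num.min del (v x1 - I) by rewrite lt_min del0 subr_gt0.
  have [_ [t t0 <-] vt] := inf_adherent e0 hS.
  exists t => //; split; apply: (lt_le_trans vt); rewrite -/I.
    by rewrite lerD2l ge_min lexx.
  by rewrite -lerBrDl ge_min lexx orbT.
have tR : R0 + 2 < t.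
  rewrite ltNge; apply/negP => tR; move: vt1; rewrite ltNge x1min //.
  by rewrite in_itv /= tR ltW.
have t1 : 1 <= t by lra.
pose h y := v y - del * odd_bump t y.
have hN y : h (- y) = - h y by rewrite /h v_odd odd_bumpN; ring.
have ch : continuous h.
  move=> y; apply: cvgB; first exact: v_cont.
  by apply: cvgM; [exact: cvg_cst|exact: continuous_odd_bump].
have hM y : `|h y| <= M + del.
  apply: (le_trans (ler_normB _ _)); apply: lerD => //.
  by rewrite normrM gtr0_norm // ger_pMr // odd_bump_norm.
have tt : t - 1 <= t + 1 by lra.
have [z zin zmin] := EVT_min tt (@continuous_subspaceT _ _ _ _ ch).
have hz : h z < I.
  apply: (@le_lt_trans _ _ (h t)); first by apply: zmin; rewrite in_itv /=; apply/andP; split; lra.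
  by rewrite /h odd_bump_pos // bump_center; lra.
have zt : t - 1 <= z <= t + 1 by move: zin; rewrite in_itv.
have z1 : 1 < z by case/andP: zt; lra.
have zR : R0 < z by case/andP: zt; lra.
have zglob y : 0 < y -> h z <= h y.
  move=> y0; have [yt|yt] := boolP (y \in `[t - 1, t + 1]); first exact: zmin.
  apply: (le_trans (ltW hz)); rewrite /h odd_bump_pos // bump_out ?mulr0 ?subr0.
    exact: infS.
  rewrite leNgt; apply: contra yt; rewrite in_itv /= ltr_norml => /andP[? ?].
  by apply/andP; split; lra.
have hz0 : h z <= 0 by lra.
have vz : v z < I + del.
  have : del * odd_bump t z <= del.
    by rewrite ger_pMr // odd_bump_pos ?bump_le1 //; lra.
  by move: hz; rewrite /h; lra.
have : c z * v z <= del * (2 * levy_mass).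
  apply: (@limit_le _ _ _ _ (4 * (M + del) * K z) 1 _ (@v_sol z)) => // e e0 e1.
  have he : 0 < e < 1 by rewrite e0.
  have bh : bounded_continuous h by split => //; exists (M + del).
  have bb : bounded_continuous (odd_bump t).
    by split; [exact: continuous_odd_bump|exists 1 => y; exact: odd_bump_norm].
  have -> : v = fun y => 1 * h y + del * odd_bump t y.
    by apply/funext => y; rewrite /h; ring.
  rewrite rtrunc_lin // mul1r addrC; apply: lerD.
    rewrite ler_pM2l //.
    have := @rtrunc_le_second_difference _ 4 z e bb he _
      (fun w => odd_bump_second_difference w t1 z1).
    by move=> /(_ (ler0n _ 4)); lra.
  have ez : e < z by lra.
  have := rtrunc_at_negative_min hN ch hM he ez hz0 zglob.
  have : h z * (z * K (2 * z)) <= 0.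
    rewrite mulr_le0_ge0 // mulr_ge0 //; first lra.
    by apply/ltW/K_pos; rewrite gt_eqF //; lra.
  by lra.
apply/negP; rewrite -ltNge.
have cz := c_far z zR.
have : - c0 * (I + del) <= c z * v z.
  rewrite -subr_ge0.
  have -> : c z * v z - - c0 * (I + del) = (- c0 - c z) * (- v z) + c0 * (I + del - v z) by ring.
  have delI : del < - I.
    rewrite /del ltr_pdivrMr // ltr_pM2l ?oppr_gt0 // /D; lra.
  by apply: addr_ge0; apply: mulr_ge0; lra.
apply: lt_le_trans.
have : 0 < del * c0 by exact: mulr_gt0.
have : 0 <= del * levy_mass by apply: mulr_ge0 => //; exact: ltW.
by move: delD; rewrite /D; lra.
Qed.

End linear_equation.
End levy_kernel.

(** * Behaviour at the origin, and the theorem *)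

Lemma derivable_continuous {R : realType} (f : R -> R) :
  (forall x, derivable f x 1) -> continuous f.
Proof.
by move=> df x; apply: differentiable_continuous; exact/derivable1_diffP.
Qed.

Lemma is_Ck_continuous {R : realType} (k : nat) (f : R -> R) :
  is_Ck k f -> continuous f.
Proof.
by case: k => [[_ //]|k [df _]]; apply: derivable_continuous; exact: (df 0%N).
Qed.

Lemma bounded_fun_norm {R : realType} (f : R -> R) :
  bounded_fun f -> exists M, forall x, `|f x| <= M.
Proof.
by move=> [M [_ fM]]; exists (M + 1) => x; apply: (fM (M + 1)) => //; rewrite ltrDl.
Qed.

(** For z <= 1 and s >= 1/2, z ^ (1 + 2 s) <= z ^ 2. *)
Lemma kernel_blowup {R : realType} (s lambda : R) (K : R -> R) (x : R) :
  2^-1 <= s -> 0 < lambda ->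
  (forall z, z != 0 -> lambda / `|z| `^ (1 + 2 * s) <= K z) ->
  0 < x -> 2 * x <= 1 -> lambda / (4 * x) <= x * K (2 * x).
Proof.
move=> hs l0 Kz x0 x1; have x20 : 0 < 2 * x by rewrite mulr_gt0.
have := Kz (2 * x); rewrite gt_eqF // gtr0_norm // => /(_ isT) lK.
have pow : (2 * x) `^ (1 + 2 * s) <= (2 * x) ^+ 2.
  rewrite -powR_mulrn ?(ltW x20) //; apply: ger_powR; last by lra.
  by rewrite x20.
apply: (@le_trans _ _ (x * (lambda / (2 * x) ^+ 2))).
  by rewrite le_eqVlt; apply/orP; left; apply/eqP; field; rewrite gt_eqF.
apply: ler_wpM2l; first exact: ltW.
apply: le_trans lK; apply: ler_wpM2l; first exact: ltW.
by rewrite lef_pV2 ?posrE ?powR_gt0 ?exprn_gt0.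
Qed.

(** c is bounded near 0 whereas x K (2 x) grows like 1 / x. *)
Lemma potential_dominated {R : realType} (s lambda : R) (K c : R -> R) :
  2^-1 <= s -> 0 < lambda ->
  (forall z, z != 0 -> lambda / `|z| `^ (1 + 2 * s) <= K z) ->
  continuous c ->
  exists2 r, 0 < r & forall x, 0 < x -> x < r -> c x < x * K (2 * x).
Proof.
move=> hs l0 Kz cc.
have [m _ cm] := EVT_max (@ler01 R) (@continuous_subspaceT _ _ _ _ cc).
pose B := `|c m| + 1; have B0 : 0 < B by rewrite ltr_wpDl.
exists (Num.min 2^-1 (lambda / (4 * B))).
  by rewrite lt_min invr_gt0 ltr0n /= divr_gt0 // mulr_gt0.
move=> x x0; rewrite lt_min => /andP[x2 xB].
apply: (@lt_le_trans _ _ (lambda / (4 * x))); last first.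
  by apply: kernel_blowup Kz _ _ => //; lra.
apply: (@lt_trans _ _ B).
  apply: (@le_lt_trans _ _ (c m)); first by apply: cm; rewrite in_itv /=; apply/andP; split; lra.
  by rewrite (le_lt_trans (ler_norm _)) // /B ltrDl.
rewrite ltr_pdivlMr ?mulr_gt0 //.
by move: xB; rewrite ltr_pdivlMr ?mulr_gt0 //; lra.
Qed.

Theorem theorem1p4 (R : realType) (s lambda Lambda : R) (K c : R -> R)
    (c0 R0 beta0 alpha : R) (w wt : R -> R)
    (hs : 2^-1 <= s < 1)
    (hlambda : 0 < lambda) (hLambda : lambda <= Lambda)
    (K_meas : measurable_fun [set z : R | z != 0] K)
    (K_decr : forall z1 z2 : R, 0 < z1 -> z1 < z2 -> K z2 < K z1)
    (K_pos : forall z : R, z != 0 -> 0 < K z)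
    (K_even : forall z : R, z != 0 -> K (- z) = K z)
    (K_bounds : forall z : R, z != 0 ->
       lambda / `|z| `^ (1 + 2 * s) <= K z <= Lambda / `|z| `^ (1 + 2 * s))
    (c_Linfty : c \in Lfun lebesgue_measure +oo%E)
    (hc0 : 0 < c0) (hR0 : 0 < R0) (hbeta0 : 0 < beta0)
    (c_neg : forall x : R, ~ (- R0 <= x <= R0) -> c x <= - c0)
    (c_holder : finite_holder_norm beta0 c)
    (halpha : 2 * s - 1 < alpha)
    (w_odd : forall x : R, w (- x) = - w x)
    (w_bounded : bounded_fun w)
    (w_reg : is_C1holder_loc alpha w)
    (w_sol : solves_linear_eq K c w)
    (wt_odd : forall x : R, wt (- x) = - wt x)
    (wt_bounded : bounded_fun wt)
    (wt_reg : is_C1holder_loc alpha wt)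
    (wt_sol : solves_linear_eq K c wt)
    (w_pos : forall x : R, 0 < x -> 0 < w x) :
  exists k : R, forall x : R, wt x = k * w x.
Proof.
have [s1 s2] := andP hs.
have K_le z : z != 0 -> K z <= Lambda / `|z| `^ (1 + 2 * s).
  by move=> /K_bounds/andP[].
have K_ge z : z != 0 -> lambda / `|z| `^ (1 + 2 * s) <= K z.
  by move=> /K_bounds/andP[].
have cw : continuous w := is_Ck_continuous w_reg.1.
have cwt : continuous wt := is_Ck_continuous wt_reg.1.
have [Mw hMw] := bounded_fun_norm w_bounded.
have [Mt hMt] := bounded_fun_norm wt_bounded.
have bw : bounded_continuous w by split => //; exists Mw.
have bt : bounded_continuous wt by split => //; exists Mt.
have [r r_gt0 hr] :=
  potential_dominated s1 hlambda K_ge (is_Ck_continuous c_holder.1).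
pose r0 := Num.min r R0.
have r00 : 0 < r0 by rewrite lt_min r_gt0.
have r0R : r0 <= R0 by rewrite ge_min lexx orbT.
have cq : {within `[r0, R0], continuous (fun x => wt x / w x)}.
  apply: continuous_in_subspaceT => x /set_mem /=; rewrite in_itv /= => /andP[rx _].
  apply: cvgM; first exact: cwt.
  by apply: cvgV; [rewrite gt_eqF // w_pos // (lt_le_trans r00)|exact: cw].
have [x0 x0in x0max] := EVT_max r0R cq.
have x00 : 0 < x0 by move: x0in; rewrite in_itv /= => /andP[+ _]; exact: lt_le_trans.
(* With this k, v is nonnegative on [r0, R0] and vanishes at x0. *)
pose k := wt x0 / w x0.
pose v y := k * w y + (-1) * wt y.
have vN y : v (- y) = - v y by rewrite /v w_odd wt_odd; ring.
have cv : continuous v.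
  by move=> y; apply: cvgD; apply: cvgM; first [exact: cvg_cst|exact: cw|exact: cwt].
have vM y : `|v y| <= `|k| * Mw + Mt.
  apply: (le_trans (ler_normD _ _)); rewrite !normrM normrN1 mul1r.
  by apply: lerD => //; apply: ler_wpM2l.
have v_sol x : rtrunc K v x e @[e --> 0^'+] --> c x * v x.
  exact: (solution_lin_cvg hs K_meas K_pos K_even K_le).
have v_ge0 : forall x, 0 < x -> 0 <= v x.
  apply: (weak_maximum_principle hs K_meas K_pos K_even K_decr K_le vN cv vM v_sol hc0 hR0
    (r0 := r0)).
  - by move=> x x_gt0; rewrite lt_min => /andP[xr _]; exact: hr.
  - by move=> x Rx; apply: c_neg => /andP[_]; rewrite leNgt Rx.
  - move=> x xin; have wx : 0 < w x by apply: w_pos; case/andP: xin => + _; exact: lt_le_trans.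
    have := x0max x; rewrite in_itv /= => /(_ xin); rewrite -/k ler_pdivrMr // /v; lra.
have vx0 : v x0 = 0 by rewrite /v /k divfK ?gt_eqF ?w_pos //; ring.
have v0 := strong_maximum_principle hs K_meas K_pos K_even K_decr K_le vN cv vM v_sol x00 vx0 v_ge0.
have vT x : v x = 0.
  have [x_gt0|x_lt0|<-] := ltgtP 0 x; first exact: v0.
    by rewrite -[x]opprK vN v0 ?oppr0 // oppr_gt0.
  by have := vN 0; rewrite oppr0; lra.
by exists k => x; have := vT x; rewrite /v; lra.
Qed.
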